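(* Consider general monotone fair share policies in the arrival-only model. (Upper bound) There exist absolute constants $c\ge 1$ and $C>0$ such that for every $n\ge 1$ there is a deterministic online allocation policy $A$ which, on every arrival-only instance with $n$ arriving jobs and every monotone fair share policy $I$, is feasible and $c$-approximate with respect to $I$, and disrupts each job at most $C\log n$ times. (Lower bound) For every constant $c\ge 1$ there exist a constant $\kappa>0$ and an integer $n_0$, depending only on $c$, such that for every $n\ge n_0$ and every deterministic online feasible policy $A$ that is $c$-approximate for all monotone fair share policies, there is an arrival-only instance with $n$ jobs and a monotone fair share policy on which $A$ makes at least $\kappa\log n$ disruptions per job on average, i.e. at least $\kappa\, n\log n$ disruptions in total.
   Context: Model. There is one unit of a single divisible resource. An instance is a sequence of sets of alive jobs $N^0, N^1, N^2,\dots$. In the arrival-only model $N^{t-1}\subseteq N^t$, and at each time step one new job arrives. A fair share policy $I$ specifies ideal fair shares $I(j,t)\ge 0$ for $j\in N^t$, with $\sum_{j\in N^t} I(j,t)\le 1$. It is monotone if the arrival of a job never increases another job's fair share: if $j$ arrives at time $t$, then $I(j',t)\le I(j',t-1)$ for every $j'\in N^t\setminus\{j\}$ (and, if departures are allowed, $I(j',t)\ge I(j',t-1)$ for every remaining $j'$ when a job departs at time $t$). The fair shares at time $t$ are revealed at time $t$. An allocation policy $A$ determines, at each time $t$, an allocation $A(j,t)\ge 0$ for every $j\in N^t$; it is online, i.e. the allocations at time $t$ depend only on the arrivals and fair shares up to time $t$ (the total number $n$ of jobs is assumed known a priori). It is feasible if $\sum_{j\in N^t}A(j,t)\le 1$ for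 all $t$. For $c\ge 1$, $A$ is $c$-approximate if $A(j,t)\ge I(j,t)/c$ for all $t$ and all $j\in N^t$. A disruption of job $j$ at time $t$ is a change in its allocation: $j\in N^{t-1}\cap N^t$ and $A(j,t)\ne A(j,t-1)$. The number of disruptions is counted over all jobs and times. *)

(* Defs.v *)
From mathcomp Require Import all_boot all_order all_algebra.
From mathcomp Require Import finmap.
From mathcomp Require Import reals exp.

Set Implicit Arguments.
Unset Strict Implicit.
Unset Printing Implicit Defensive.

Import Order.TTheory GRing.Theory Num.Theory.

Local Open Scope ring_scope.

(* Jobs are named by arbitrary natural numbers; a job's name carries no
   information about its arrival time. [N t] is the set of jobs alive at time
   [t]. With [n] jobs in total, only the times [t <= n] are meaningful. *)

Definition arrives (N : nat -> {fset nat}) (j t : nat) : Prop :=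
  j \notin N t.-1 /\ N t = (j |` N t.-1)%fset.

Definition arrival_only (n : nat) (N : nat -> {fset nat}) : Prop :=
  N 0%N = fset0 /\ (forall t, (0 < t <= n)%N -> exists j, arrives N j t).

Section Shares.
Variable R : realType.

(* In [I j t] and [X j t], only the values with [j \in N t] are meaningful. *)

Definition fair_shares (n : nat) (N : nat -> {fset nat})
    (I : nat -> nat -> R) : Prop :=
  forall t, (t <= n)%N ->
    (forall j, j \in N t -> 0 <= I j t) /\ \sum_(j <- N t) I j t <= 1.

Definition monotone (n : nat) (N : nat -> {fset nat})
    (I : nat -> nat -> R) : Prop :=
  forall t j, (0 < t <= n)%N -> arrives N j t ->
    forall j', j' \in N t -> j' != j -> I j' t <= I j' t.-1.

Definition monotone_input (n : nat) (N : nat -> {fset nat})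
    (I : nat -> nat -> R) : Prop :=
  [/\ arrival_only n N, fair_shares n N I & monotone n N I].

(* What is revealed at time [s] is a finite map: its domain is [N s], and it
   sends each alive job to its fair share. A policy sees the list of these maps
   for the times [0, ..., t], hence it is deterministic and online by typing. *)

Definition policy : Type := seq {fmap nat -> R} -> nat -> R.

Definition revealed (N : nat -> {fset nat}) (I : nat -> nat -> R)
    (s : nat) : {fmap nat -> R} :=
  [fmap j : N s => I (val j) s]%fmap.

Definition run (A : policy) (N : nat -> {fset nat}) (I : nat -> nat -> R)
    (j t : nat) : R :=
  A [seq revealed N I s | s <- iota 0 t.+1] j.

Definition feasible (n : nat) (N : nat -> {fset nat})
    (X : nat -> nat -> R) : Prop :=
  forall t, (t <= n)%N ->
    (forall j, j \in N t -> 0 <= X j t) /\ \sum_(j <- N t) X j t <= 1.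

Definition approximate (c : R) (n : nat) (N : nat -> {fset nat})
    (I X : nat -> nat -> R) : Prop :=
  forall t j, (t <= n)%N -> j \in N t -> I j t / c <= X j t.

Definition disrupted (N : nat -> {fset nat}) (X : nat -> nat -> R)
    (j t : nat) : bool :=
  [&& j \in N t.-1, j \in N t & X j t != X j t.-1].

Definition disruptions (n : nat) (N : nat -> {fset nat})
    (X : nat -> nat -> R) (j : nat) : nat :=
  (\sum_(1 <= t < n.+1) disrupted N X j t)%N.

Definition total_disruptions (n : nat) (N : nat -> {fset nat})
    (X : nat -> nat -> R) : nat :=
  (\sum_(j <- N n) disruptions n N X j)%N.

End Shares.

(* Main.v *)
(* Upper bound: allocate to each job half of its share, rounded down to a power
   of 2 but never below [2 ^- K], where [K] is about [log2 n]. Shares only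
   decrease, so a job runs through at most [K + 1] values, and the roundings up
   add at most [n * 2 ^- K <= 1] in total.

   Lower bound: give each new job the share [1/2], and let every older job's
   share fall to half of its current allocation. A single disruption can then
   shrink an allocation by a factor of at most [2 * c], so a job disrupted [d]
   times still holds at least [(2 * c) ^- (d + 1)]. The [n] final allocations
   add up to at most [1], so the average of [d] is of order [ln n]. *)

Require Import Defs.
From mathcomp Require Import all_boot all_order all_algebra.
From mathcomp Require Import finmap.
From mathcomp Require Import reals exp.
From mathcomp Require Import lra.

Set Implicit Arguments.
Unset Strict Implicit.
Unset Printing Implicit Defensive.

Import Order.TTheory GRing.Theory Num.Theory.

Local Open Scope ring_scope.

(** * Arrival-only instances with monotone shares *)

Lemma revealedE (R : realType) (N : nat -> {fset nat}) (I : nat -> nat -> R)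
  (t j : nat) : j \in N t -> odflt 0 ((revealed N I t).[? j])%fmap = I j t.
Proof. by move=> jN; rewrite in_fnd ffunE. Qed.

Lemma arrives_sub (n : nat) (N : nat -> {fset nat}) (t j : nat) :
  arrival_only n N -> (t < n)%N -> j \in N t -> j \in N t.+1.
Proof.
move=> [_ /(_ t.+1)]; rewrite ltnS leq0n => arrN tn jN.
by case: (arrN tn) => i [/= _ ->]; rewrite in_fset1U jN orbT.
Qed.

Lemma card_arrived (n : nat) (N : nat -> {fset nat}) (t : nat) :
  arrival_only n N -> (t <= n)%N -> #|` N t| = t.
Proof.
move=> [N0 arrN]; elim: t => [|t IH] tn; first by rewrite N0 cardfs0.
case: (arrN t.+1 tn) => i [/= iN ->].
by rewrite cardfsU1 iN IH // ltnW.
Qed.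

Lemma monotone_share (R : realType) (n : nat) (N : nat -> {fset nat})
    (I : nat -> nat -> R) (t j : nat) :
  monotone_input n N I -> (t < n)%N -> j \in N t -> I j t.+1 <= I j t.
Proof.
move=> [arrN _ monI] tn jN.
have [i arri] := arrN.2 t.+1 tn.
apply: (monI t.+1 i) => //; first exact: arrives_sub arrN tn jN.
by apply: contraNneq arri.1 => <-.
Qed.

(** * Upper bound: rounding shares to powers of 2 *)

Section Level.
Variables (R : realType) (K : nat).
Implicit Types x y : R.

(** [find] defaults to the length [K] when every test fails; this default is the floor [2 ^- K] on
    the rounded share. *)
Definition level x : nat := find (fun k => 2 ^- k <= x) (iota 0 K).

Lemma level_le x : (level x <= K)%N.
Proof. by rewrite -[leqRHS](size_iota 0) find_size. Qed.

Lemma level_anti x y : x <= y -> (level y <= level x)%N.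
Proof. by move=> xy; apply: sub_find => k /= /le_trans; apply. Qed.

Lemma level_upper x : 0 <= x -> 2 ^- (level x) <= x + 2 ^- K.
Proof.
move=> x0; have := level_le x; rewrite leq_eqVlt => /orP[/eqP ->|lK].
  by rewrite lerDr.
apply: (le_trans _ (_ : x <= _)); last by rewrite lerDl invr_ge0 exprn_ge0.
have := nth_find 0%N (a := fun k => 2 ^- k <= x) (s := iota 0 K).
by rewrite has_find size_iota nth_iota // add0n; apply.
Qed.

(** The exponent just before [level x] failed the test; at level 0 the bound on [x] takes over. *)
Lemma level_lower x : x <= 1 -> x <= 2 * 2 ^- (level x).
Proof.
case E: (level x) => [|k] x1; first by rewrite expr0 invr1; lra.
have kK : (k < K)%N by rewrite -E level_le.
have := @before_find _ 0%N (fun k => 2 ^- k <= x) (iota 0 K) k.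
rewrite -/(level x) E ltnSn nth_iota // add0n => /(_ isT)/negbT.
by rewrite -ltNge exprS invfM mulrA divff ?mul1r ?pnatr_eq0 // => /ltW.
Qed.

End Level.

Definition level_policy (R : realType) (K : nat) : policy R :=
  fun h j => 2 ^- (level K (odflt 0 (last [fmap] h).[? j]%fmap)).+1.

Lemma run_level_policy (R : realType) (K : nat) (N : nat -> {fset nat})
    (I : nat -> nat -> R) (t j : nat) : j \in N t ->
  run (level_policy K) N I j t = 2 ^- (level K (I j t)).+1.
Proof.
move=> jN; rewrite /run /level_policy -[t.+1]addn1 iotaD map_cat last_cat /=.
by rewrite add0n revealedE.
Qed.

Lemma level_policy_feasible (R : realType) (n K : nat) (N : nat -> {fset nat})
    (I : nat -> nat -> R) : monotone_input n N I -> (n <= 2 ^ K)%N ->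
  feasible n N (run (level_policy K) N I).
Proof.
move=> [arrN fairI monI] nK t tn; split=> [j jN|].
  by rewrite run_level_policy // invr_ge0 exprn_ge0.
have [I0 I1] := fairI t tn.
apply: (@le_trans _ _ (\sum_(j <- N t) 2^-1 * (I j t + 2 ^- K))).
  rewrite big_seq [leRHS]big_seq; apply: ler_sum => j jN.
  rewrite run_level_policy // exprS invfM ler_wpM2l ?invr_ge0 //.
  exact/level_upper/I0.
rewrite -big_distrr /= big_split /= big_const_seq count_predT iter_addr_0.
rewrite (card_arrived arrN tn).
(* After halving, the shares and the [t] floors each use at most half of the resource. *)
suff : 2 ^- K *+ t <= (1 : R) by lra.
rewrite -[2 ^- K *+ t]mulr_natl ler_pdivrMr ?exprn_gt0 // mul1r -natrX ler_nat.
exact: leq_trans nK.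
Qed.

Lemma fair_share_le1 (R : realType) (n : nat) (N : nat -> {fset nat})
    (I : nat -> nat -> R) (t j : nat) :
  fair_shares n N I -> (t <= n)%N -> j \in N t -> I j t <= 1.
Proof.
move=> fairI tn jN; have [I0 I1] := fairI t tn.
apply: le_trans I1; rewrite (big_rem j) //= lerDl big_seq sumr_ge0 // => i.
by move/mem_rem/I0.
Qed.

(** One factor 2 comes from the halving, the other from the rounding. *)
Lemma level_policy_approximate (R : realType) (n K : nat)
    (N : nat -> {fset nat}) (I : nat -> nat -> R) :
  monotone_input n N I -> approximate 4 n N I (run (level_policy K) N I).
Proof.
move=> [arrN fairI monI] t j tn jN; rewrite run_level_policy // exprS invfM.
have := level_lower K (fair_share_le1 fairI tn jN); lra.
Qed.

Lemma level_policy_disruptions (R : realType) (n K : nat)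
    (N : nat -> {fset nat}) (I : nat -> nat -> R) (j : nat) :
  monotone_input n N I ->
  (disruptions n N (run (level_policy K) N I) j <= K)%N.
Proof.
move=> inp; set X := run _ _ _.
(* The current level is a potential: it never falls while [j] is alive, and each disruption raises
   it. Before the arrival of [j] the count is 0. *)
suff H t : (t <= n)%N ->
    (\sum_(1 <= s < t.+1) disrupted N X j s
       <= if j \in N t then level K (I j t) else 0)%N.
  by apply: leq_trans (H n (leqnn n)) _; case: ifP => // _; apply: level_le.
elim: t => [|t IH] tn; first by rewrite big_geq.
rewrite big_nat_recr //=; have {IH} := IH (ltnW tn).
case jN: (j \in N t); last first.
  by rewrite leqn0 => /eqP ->; rewrite add0n /disrupted /= jN.
have [arrN _ _] := inp.
have jN1 := arrives_sub arrN tn jN; rewrite jN1 => IH.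
have le_l := level_anti K (monotone_share inp tn jN).
rewrite /disrupted jN jN1 /X !run_level_policy //=.
case: eqVneq => [_|neq]; first by rewrite addn0 (leq_trans IH).
rewrite addn1; apply: leq_ltn_trans IH _; rewrite ltn_neqAle le_l andbT.
by apply: contraNneq neq => ->.
Qed.

(** The rounded-up logarithm is at most [1 + log2 n], and [1 <= log2 n] once [n >= 2]; for [n = 1]
    both sides vanish. *)
Lemma up_log_ln (R : realType) (n : nat) :
  (0 < n)%N -> (up_log 2 n)%:R <= 2 / ln 2 * ln (n%:R : R).
Proof.
move=> n0; have ln2 : 0 < ln (2 : R) by rewrite ln_gt0 // ltr1n.
rewrite mulrAC ler_pdivlMr //.
have [->|n1] : n = 1%N \/ (1 < n)%N by case: (n) n0 => [|[|]]; auto.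
  by rewrite up_log1 ln1 mul0r mulr0.
have lnn : ln 2 <= ln (n%:R : R) by rewrite ler_ln ?posrE ?ltr0n // ler_nat.
have := up_log_bounds (isT : 1 < 2)%N n1; case/andP.
case: (up_log 2 n) => [|k] /=.
  by rewrite mul0r mulr_ge0 // (le_trans _ lnn) ?ltW.
move=> kn _; have : ln (2 ^+ k : R) <= ln n%:R.
  by rewrite ler_ln ?posrE ?ltr0n // ?exprn_gt0 // -natrX ler_nat ltnW.
rewrite lnXn // -[ln 2 *+ k]mulr_natl -natr1; lra.
Qed.

(** * Lower bound: the adaptive instance *)

Section Adversary.
Variables (R : realType) (A : policy R).

(** Job [t] is thus the one that arrives at time [t.+1]. *)
Definition alive (t : nat) : {fset nat} := [fset j in iota 0 t]%fset.

Lemma in_alive t j : (j \in alive t) = (j < t)%N.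
Proof. by rewrite in_fset /= mem_iota. Qed.

Lemma sum_alive (F : nat -> R) t : \sum_(j <- alive t) F j = \sum_(j < t) F j.
Proof.
rewrite -(big_mkord xpredT) /index_iota subn0; apply: perm_big.
apply: uniq_perm; rewrite ?fset_uniq ?iota_uniq // => j.
by rewrite in_alive mem_iota.
Qed.

(* Freezing the shares once the policy is infeasible makes the instance
   monotone and fair for every policy, so that no circularity arises when the
   hypothesis on the policy is applied to it. *)
Definition next_shares (t : nat) (i x : nat -> R) (j : nat) : R :=
  if [forall k : 'I_t, 0 <= x k] && (\sum_(k < t) x k <= 1)
  then if j == t then 2^-1 else Num.min (i j) (x j / 2)
  else if j == t then 0 else i j.

(** Shares and allocations depend on each other; carrying the revealed history lets the recursion
    query [A] on the past before it fixes the next shares. *)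
Fixpoint adversary (t : nat) : (nat -> R) * seq {fmap nat -> R} :=
  if t is t'.+1 then
    let: (i, h) := adversary t' in
    let i' := next_shares t' i (A h) in
    (i', rcons h [fmap j : alive t => i' (val j)]%fmap)
  else (fun=> 0, [:: [fmap j : alive 0 => 0]%fmap]).

Definition adv_share (j t : nat) : R := (adversary t).1 j.

Let X := run A alive adv_share.

Lemma adversary_history t :
  (adversary t).2 = [seq revealed alive adv_share s | s <- iota 0 t.+1].
Proof.
elim: t => [//|t IH].
rewrite -[t.+2]addn1 iotaD map_cat -IH cats1 /=.
by rewrite /revealed /adv_share add0n /=; case: (adversary t).
Qed.

Lemma adv_shareS j t :
  adv_share j t.+1 = next_shares t (adv_share^~ t) (X^~ t) j.
Proof.
rewrite /X /run -adversary_history /adv_share /=.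
by case: (adversary t).
Qed.

Lemma alive_arrival n : arrival_only n alive.
Proof.
split=> [|[//|t] _]; first by apply/fsetP => j; rewrite in_alive inE.
exists t; split=> /=; first by rewrite in_alive ltnn.
by apply/fsetP => j; rewrite in_fset1U !in_alive ltnS leq_eqVlt.
Qed.

Lemma adv_share_anti j t : (j < t)%N -> adv_share j t.+1 <= adv_share j t.
Proof.
move=> jt; rewrite adv_shareS /next_shares (ltn_eqF jt).
by case: ifP => // _; rewrite ge_min lexx.
Qed.

Lemma adv_share_fair t :
  (forall j, (j < t)%N -> 0 <= adv_share j t) /\
  \sum_(j < t) adv_share j t <= 1.
Proof.
elim: t => [|t [I0 I1]]; first by split=> //; rewrite big_ord0.
split=> [j|].
  rewrite adv_shareS /next_shares ltnS leq_eqVlt.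
  case: eqVneq => [-> _|_ /= jt]; first by case: ifP; rewrite ?invr_ge0.
  case: ifP => [/andP[/forallP/(_ (Ordinal jt)) /= x0 _]|_]; last exact: I0.
  by rewrite le_min I0 // divr_ge0.
rewrite big_ord_recr /= !adv_shareS /next_shares eqxx.
under eq_bigr => j _ do rewrite adv_shareS /next_shares (ltn_eqF (ltn_ord j)).
case: ifP => [/andP[_ x1]|_]; last by rewrite addr0.
suff : \sum_(j < t) Num.min (adv_share j t) (X j t / 2) <= 2^-1 by lra.
apply: (@le_trans _ _ (\sum_(j < t) X j t / 2)).
  by apply: ler_sum => j _; rewrite ge_min lexx orbT.
by rewrite -big_distrl /=; lra.
Qed.

Lemma adv_monotone_input n : monotone_input n alive adv_share.
Proof.
split; first exact: alive_arrival.
  move=> t _; rewrite sum_alive; have [I0 I1] := adv_share_fair t.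
  by split=> // j; rewrite in_alive; apply: I0.
move=> [//|t] j _ [/=]; rewrite in_alive -leqNgt => tj defN j'.
have : t \in (j |` alive t)%fset by rewrite -defN in_alive.
rewrite in_fset1U !in_alive ltnn orbF => /eqP <-.
rewrite ltnS leq_eqVlt => /orP[->//|jt _].
exact: adv_share_anti.
Qed.

(** * Allocations of a feasible approximate policy on this instance *)

Section Run.
Variables (c : R) (n : nat).
Hypothesis c1 : 1 <= c.
Hypothesis feasX : feasible n alive X.
Hypothesis apprX : approximate c n alive adv_share X.

Lemma adv_share_next j t : (t <= n)%N -> adv_share j t.+1 =
  if j == t then 2^-1 else Num.min (adv_share j t) (X j t / 2).
Proof.
move=> tn; have [X0 X1] := feasX tn.
rewrite adv_shareS /next_shares ifT // -sum_alive X1 andbT.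
by apply/forallP => k; rewrite X0 // in_alive.
Qed.

(* [min (I, X / 2)] is the share the job receives next. It can only change
   when [X] does, and then by a factor at most [2 * c]. *)
Lemma next_share_lower j t : (j < t <= n)%N ->
  2^-1 * (2 * c) ^- (\sum_(1 <= s < t.+1) disrupted alive X j s).+1
    <= Num.min (adv_share j t) (X j t / 2).
Proof.
have c0 : 0 < c by apply: lt_le_trans c1.
have c2 : 1 <= 2 * c by move: c1 c0; lra.
elim: t => [//|t IH] /andP[jt tn].
have := @apprX t.+1 j tn; rewrite in_alive => /(_ jt).
rewrite big_nat_recr //=; move: jt; rewrite ltnS leq_eqVlt.
(* If [j] has just arrived, it has no disruption yet, and its share [1/2] forces an allocation of at
   least [1 / (2 * c)]. *)
case/orP=> [/eqP jt|jt].
  rewrite big_nat big1 => [|s /andP[_ st]]; last first.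
    rewrite /disrupted in_alive jt [(t < _)%N]ltnNge.
    by rewrite (leq_trans (leq_pred s) _).
  rewrite add0n /disrupted !in_alive jt /= ltnn /= expr1.
  rewrite adv_share_next ?(ltnW tn) // eqxx => X2.
  rewrite le_min; apply/andP; split.
    by rewrite ger_pMr ?invr_gt0 // invf_le1 // (lt_le_trans _ c2).
  by rewrite invfM [leLHS]mulrC ler_pM2r ?invr_gt0.
have {}IH := IH (introT andP (conj jt (ltnW tn))).
rewrite adv_share_next ?(ltnW tn) // (ltn_eqF jt) => X2.
have I0 : 0 <= 2^-1 * (2 * c) ^- (\sum_(1 <= s < t.+1)
    disrupted alive X j s).+1.
  by rewrite mulr_ge0 ?invr_ge0 // exprn_ge0 // (le_trans _ c2).
move: IH I0 X2; set d := \sum_(_ <= _ < _) _; set m := Num.min _ _ => IH I0 X2.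
rewrite /disrupted !in_alive /= jt ltnS (ltnW jt) /=.
case: eqVneq => [->|_] /=.
  by rewrite addn0 le_min IH (le_trans IH) // /m ge_min lexx orbT.
(* After a disruption, the approximation still forces an allocation of at least [m / c], as [m] is
   now the share. *)
have H : 2^-1 * (2 * c) ^- (d + 1).+1 <= m / (2 * c).
  by rewrite addn1 [_ ^+ d.+2]exprSr invfM mulrA ler_pM2r ?invr_gt0 ?mulr_gt0.
rewrite le_min; apply/andP; split; apply: (le_trans H).
  rewrite ler_pdivrMr ?mulr_gt0 // ler_peMr //.
  exact: le_trans I0 IH.
by rewrite invfM mulrA mulrAC ler_pM2r ?invr_gt0.
Qed.

Lemma allocation_lower j : (j < n)%N ->
  (2 * c) ^- (disruptions n alive X j).+1 <= X j n.
Proof.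
move=> jn; have := @next_share_lower j n; rewrite jn leqnn => /(_ isT).
by rewrite le_min => /andP[_]; rewrite mulrC ler_pM2r ?invr_gt0.
Qed.

(* Tangent of [exp] at [- ln n], i.e. Jensen's inequality for the
   [(2 * c) ^- (d_j + 1)], whose sum is at most [1]. *)
Lemma sum_disruptions_lower : (0 < n)%N ->
  n%:R * ln n%:R
    <= \sum_(j < n) (disruptions n alive X j).+1%:R * ln (2 * c).
Proof.
move=> n0; have c2 : 0 < 2 * c by rewrite mulr_gt0 // (lt_le_trans _ c1).
have n0R : 0 < n%:R :> R by rewrite ltr0n.
set d := fun j => disruptions n alive X j.
have tangent (j : 'I_n) :
    1 + (ln n%:R - (d j).+1%:R * ln (2 * c)) <= n%:R * X j n.
  apply: (le_trans (expR_ge1Dx _)).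
  rewrite expRD lnK ?posrE // ler_pM2l // expRN.
  rewrite mulr_natl -lnXn // lnK ?posrE ?exprn_gt0 //.
  exact: allocation_lower.
(* The constants 1 add up to [n], which cancels against [n] times the total allocation. *)
have := ler_sum (index_enum 'I_n) (P := xpredT) (fun j _ => tangent j).
rewrite -big_distrr /= big_split sumrB /= !sumr_const card_ord.
rewrite -[ln _ *+ n]mulr_natl.
have [_] := feasX (leqnn n); rewrite sum_alive => X1.
have : n%:R * \sum_(j < n) X j n <= n%:R * 1 by rewrite ler_pM2l.
lra.
Qed.

End Run.
End Adversary.

(** * Choice of the constants for both bounds *)

Theorem theorem1p6 (R : realType) :
  (exists c C : R, [/\ 1 <= c, 0 < C &
     forall n : nat, (1 <= n)%N ->
     exists A : policy R,
     forall (N : nat -> {fset nat}) (I : nat -> nat -> R),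
       monotone_input n N I ->
       [/\ feasible n N (run A N I),
           approximate c n N I (run A N I) &
           forall j, j \in N n ->
             (disruptions n N (run A N I) j)%:R <= C * ln (n%:R : R)]])
  /\
  (forall c : R, 1 <= c ->
     exists (kappa : R) (n0 : nat), 0 < kappa /\
     forall n : nat, (n0 <= n)%N ->
     forall A : policy R,
       (forall (N : nat -> {fset nat}) (I : nat -> nat -> R),
          monotone_input n N I ->
          feasible n N (run A N I) /\ approximate c n N I (run A N I)) ->
       exists (N : nat -> {fset nat}) (I : nat -> nat -> R),
         monotone_input n N I /\
         kappa * (n%:R * ln (n%:R : R))
           <= (total_disruptions n N (run A N I))%:R).
Proof.
split.
  exists 4, (2 / ln 2); split; first by rewrite ler1n.
    by rewrite divr_gt0 // ln_gt0 // ltr1n.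
  move=> n n0; exists (level_policy (up_log 2 n)) => N I inp; split.
  - exact/level_policy_feasible/up_logP.
  - exact: level_policy_approximate.
  - move=> j _; apply: le_trans (up_log_ln R n0).
    by rewrite ler_nat level_policy_disruptions.
move=> c c1; have c2 : 1 < 2 * c by lra.
have c0 : 0 < 2 * c by lra.
have L0 : 0 < ln (2 * c) by rewrite ln_gt0.
(* For [n > (2 * c) ^+ 2], the extra 1 in each [d_j + 1] costs [n * ln (2 * c)] in total, at most
   half of [n * ln n]; the other half gives [kappa]. *)
exists (2 * ln (2 * c))^-1, (Num.bound ((2 * c) ^+ 2)); split.
  by rewrite invr_gt0 mulr_gt0.
move=> n nlarge A Aok; have inp := adv_monotone_input A n.
have [feasX apprX] := Aok _ _ inp.
exists alive, (adv_share A); split=> //.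
have cn : (2 * c) ^+ 2 < n%:R.
  apply: lt_le_trans (_ : (Num.bound ((2 * c) ^+ 2))%:R <= _).
    by rewrite archi_boundP // exprn_ge0 // ltW.
  by rewrite ler_nat.
have n0 : 0 < n%:R :> R by apply: lt_trans cn; rewrite exprn_gt0.
have lnn : 2 * ln (2 * c) <= ln n%:R.
  by rewrite mulr_natl -lnXn // ler_ln ?posrE ?exprn_gt0 // ltW.
have := sum_disruptions_lower c1 feasX apprX; rewrite -(ltr0n R).
move=> /(_ n0); rewrite -big_distrl /= /total_disruptions natr_sum sum_alive.
under eq_bigr => j _ do rewrite -natr1.
rewrite big_split /= sumr_const card_ord mulrDl => H.
rewrite mulrC ler_pdivrMr ?mulr_gt0 //.
have : n%:R * (2 * ln (2 * c)) <= n%:R * ln n%:R :> R by rewrite ler_pM2l.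
lra.
Qed.
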